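(* Let $x^*$ be an $\epsilon$-optimal solution of the CDLP, and let $V^{FCFS}(C,0)$ be the expected total reward of the first-come-first-served algorithm $FCFS$ based on $x^*$ (under static substitution). Then $$V^{FCFS}(C,0)\ \ge\ \frac1e(1-\epsilon)\,V^{OFF}.$$
   Context: **Model.** The horizon is $[0,1]$. There are $L$ resources, $N$ products and $K$ customer types. Resource $l$ has initial integer capacity $C_l$ ($C=(C_1,\dots,C_L)$) and an expiration time $t_l$. Product $n\in\{1,\dots,N\}$ uses one unit of a single resource $l_n$ and earns reward $r_n\ge0$; $N_l=\{n:l_n=l\}$. Product $0$ is the no-purchase option, $r_0=0$. An assortment is a subset of $\{0,1,\dots,N\}$ containing $0$; $\mathcal S$ is the set of all assortments. Type-$k$ customers arrive according to independent non-homogeneous Poisson processes with known integrable rates $\lambda_k(t)\ge0$; $\Lambda_k=\int_0^1\lambda_k(s)ds$. A type-$k$ customer offered $S$ chooses exactly one $n\in S$, product $n$ with probability $P^k(n,S)$ ($\sum_{n\in S}P^k(n,S)=1$), independently of everything else given type and offered assortment; the choice model is otherwise arbitrary and may differ by type. Types are defined so that if type $k$ can arrive after time $t_l$, then $P^k(n,S)=0$ for all $n\in N_l$, $S\ni n$. When a product $n\ge1$ is purchased, $r_n$ is earned and the inventory of resource $l_n$ drops by one. **Offline benchmark.** An offline policy knows at time $0$ the full realization of the arrivals (times and types), but not the customers' random choices. It offers each arriving customer an assortment (possibly randomized) depending on the arrival realization and past choices, never offering a product whose resource has zero remaining inventory. $V^{OFF}$ is the optimal expected total reward over offline policies. **CDLP.**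 $V^{CDLP}=\max_x\sum_{k}\sum_{S\in\mathcal S}\Lambda_kx_k(S)\sum_{n\in S}P^k(n,S)r_n$ subject to $\sum_k\Lambda_k\sum_{n\in N_j}\sum_{S\in\mathcal S:n\in S}x_k(S)P^k(n,S)\le C_j$ for $j=1,\dots,L$; $\sum_{S\in\mathcal S}x_k(S)\le1$ for all $k$; $x_k(S)\ge0$. A feasible $x$ is *$\epsilon$-optimal* ($\epsilon\in[0,1]$) if its objective value is at least $(1-\epsilon)V^{CDLP}$. **FCFS.** Given $x^*$, upon each type-$k$ arrival, offer a random assortment $A_k^{Static}$ with $P(A_k^{Static}=S)=x_k^*(S)$ (with any remaining probability $1-\sum_Sx_k^*(S)$ only the no-purchase option $\{0\}$ is offered), drawn independently of the time, of the inventory and of all else. The assortment may contain products whose resource is out of stock, and choices are unaffected by inventory (static substitution). If the customer chooses $n\ge1$ and resource $l_n$ has positive remaining inventory, the customer purchases $n$; otherwise the customer is rejected (no reward, inventory unchanged). *)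

(* Defs.v *)
From HB Require Import structures.
From mathcomp Require Import all_boot all_order all_algebra.
From mathcomp Require Import all_classical all_reals all_analysis.

Set Implicit Arguments.
Unset Strict Implicit.
Unset Printing Implicit Defensive.

Import Order.TTheory GRing.Theory Num.Theory.
Import numFieldNormedType.Exports.

Local Open Scope classical_set_scope.
Local Open Scope ring_scope.

(* MathComp-Analysis.  Products are [option 'I_N]: [None] is the no-purchase
   option (product 0) and [Some j] is the (j+1)-st product. *)
Notation assortment N := {S : {set option 'I_N} | None \in S}.

Definition only_no_purchase (N : nat) : assortment N :=
  exist _ [set None]%SET (set11 None).

Record model (R : realType) (L N K : nat) := Model {
  capacity : 'I_L -> nat;
  expiry : 'I_L -> R;
  resource : 'I_N -> 'I_L;
  price : 'I_N -> R;
  rate : 'I_K -> R -> R;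
  (* [choice_prob k n S] is only meaningful for [n \in S] *)
  choice_prob : 'I_K -> option 'I_N -> assortment N -> R;
  price_ge0 : forall j, 0 <= price j;
  rate_ge0 : forall k t, 0 <= t <= 1 -> 0 <= rate k t;
  rate_integrable : forall k,
    lebesgue_measure.-integrable `[0, 1] (EFin \o rate k);
  choice_ge0 : forall k n (S : assortment N), n \in val S -> 0 <= choice_prob k n S;
  choice_sum1 : forall k (S : assortment N),
    \sum_(n in val S) choice_prob k n S = 1;
  (* a type can arrive after [expiry l] iff its intensity has positive mass
     on that part of the horizon *)
  choice_expired : forall k l,
    0 < \int[lebesgue_measure]_(t in `[0, 1] `&` `]expiry l, +oo[) rate k t ->
    forall j (S : assortment N), resource j = l -> Some j \in val S ->
      choice_prob k (Some j) S = 0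
}.

(** Arrivals *)

(* An arrival realization: the chronological list of (time, type) pairs. *)
Definition arrivals (R : realType) (K : nat) : Type := seq (R * 'I_K).

HB.instance Definition _ (R : realType) (K : nat) :=
  Choice.on (arrivals R K).
HB.instance Definition _ (R : realType) (K : nat) :=
  isPointed.Build (arrivals R K) [::].

(* The sigma-algebra on realizations is generated by the sequence of types and
   the individual arrival times; it is the sum over type sequences [s] of the
   Borel sigma-algebras of R^(size s). *)
Definition arrival_cylinders (R : realType) (K : nat) :
    set (set (arrivals R K)) :=
  [set E | (exists s : seq 'I_K, E = [set a | map snd a = s]) \/
           (exists i (B : set R), measurable B /\
              E = [set a | B (nth 0 (map fst a) i)])].

Notation arrival_space R K := (g_sigma_algebraType (@arrival_cylinders R K)).

Definition type_times (R : realType) (K : nat) (k : 'I_K) (a : arrivals R K) :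
    seq R :=
  [seq p.1 | p <- a & p.2 == k].

Definition count_in (R : realType) (B : set R) (ts : seq R) : nat :=
  count (fun t => t \in B) ts.

Definition subhorizon (R : realType) (I : interval R) : Prop :=
  [set` I] `<=` `[0, 1].

Section poisson.
Context (R : realType) (d : measure_display) (Omega : measurableType d).
Variable P : probability Omega R.

(* [poisson_prob m k U] does not depend on [k]; unlike [poisson_pmf], it is the
   Dirac mass at 0 when [m = 0]. *)
Definition is_poisson_process (lambda : R -> R) (X : Omega -> seq R) : Prop :=
  (forall I : interval R, subhorizon I -> forall U : set nat,
     P [set w | U (count_in [set` I] (X w))] =
     poisson_prob (\int[lebesgue_measure]_(t in [set` I]) lambda t) 0 U) /\
  (forall (m : nat) (I : 'I_m -> interval R) (c : 'I_m -> nat),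
     (forall i, subhorizon (I i)) ->
     trivIset setT (fun i => [set` I i]) ->
     P [set w | forall i, count_in [set` I i] (X w) = c i] =
     (\prod_(i < m) P [set w | count_in [set` I i] (X w) = c i])%E).

(* Product rule on the finite-dimensional events, a pi-system generating the
   sigma-algebra of each process. *)
Definition independent_processes (K : nat) (X : 'I_K -> Omega -> seq R) : Prop :=
  forall (m : nat) (I : 'I_K -> 'I_m -> interval R) (c : 'I_K -> 'I_m -> nat),
    (forall k i, subhorizon (I k i)) ->
    P [set w | forall k i, count_in [set` I k i] (X k w) = c k i] =
    (\prod_(k < K) P [set w | forall i, count_in [set` I k i] (X k w) = c k i])%E.

Definition is_arrival_process (L N K : nat) (M : model R L N K)
    (A : Omega -> arrivals R K) : Prop :=
  [/\ measurable_fun setT (A : Omega -> arrival_space R K),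
      (forall w, sorted <=%R (map fst (A w)) /\
         forall p, p \in (A w : seq _) -> 0 <= p.1 <= 1),
      (forall k, is_poisson_process (rate M k) (fun w => type_times k (A w))) &
      independent_processes (fun k w => type_times k (A w))].

End poisson.

(** Sales dynamics *)

(* The successive (offered assortment, customer's choice) pairs. *)
Notation history N := (seq (assortment N * option 'I_N)).

Section dynamics.
Context (R : realType) (L N K : nat) (M : model R L N K).

Definition reward (n : option 'I_N) : R := if n is Some j then price M j else 0.

Definition in_stock (c : 'I_L -> nat) (n : option 'I_N) : bool :=
  if n is Some j then (0 < c (resource M j))%N else true.

Definition update (c : 'I_L -> nat) (n : option 'I_N) : 'I_L -> nat :=
  if n is Some j then
    if in_stock c n then fun l => (c l - (l == resource M j))%N else c
  else c.

Definition inventory (h : history N) : 'I_L -> nat :=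
  foldl update (capacity M) (map snd h).

Fixpoint reward_from (c : 'I_L -> nat) (ns : seq (option 'I_N)) : R :=
  if ns is n :: ns' then
    (if in_stock c n then reward n else 0) + reward_from (update c n) ns'
  else 0.

Definition total_reward (h : history N) : R :=
  reward_from (capacity M) (map snd h).

(* Expectation of [f (full history)] given the past history [h] and the arrivals
   [a] still to be served, when the type-[k] customer arriving after history
   [h'] is offered [S] with probability [offer h' k S] and then chooses [n] with
   probability [choice_prob M k n S]: integration against the composition of these
   (finitely supported) transition kernels. *)
Fixpoint expectation_from (offer : history N -> 'I_K -> assortment N -> R)
    (f : history N -> R) (h : history N) (a : seq (R * 'I_K)) : R :=
  if a is (_, k) :: a' then
    \sum_(S : assortment N) offer h k S *
      \sum_(n in val S) choice_prob M k n S *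
        expectation_from offer f (rcons h (S, n)) a'
  else f h.

Definition expected_reward (offer : history N -> 'I_K -> assortment N -> R)
    (a : arrivals R K) : R :=
  expectation_from offer total_reward [::] a.

(** Offline benchmark *)

(* [policy a h S]: probability of offering [S] to the (size h).+1-st arrival of
   the realization [a] after the history [h]. *)
Definition is_offline_policy
    (policy : arrivals R K -> history N -> assortment N -> R) : Prop :=
  [/\ (forall a h S, 0 <= policy a h S),
      (forall a h, \sum_(S : assortment N) policy a h S = 1),
      (forall h S,
         measurable_fun setT (fun a : arrival_space R K => policy a h S)) &
      (forall a h (S : assortment N) j, 0 < policy a h S -> Some j \in val S ->
         (0 < inventory h (resource M j))%N)].

Section values.
Context (d : measure_display) (Omega : measurableType d).
Variables (P : probability Omega R) (A : Omega -> arrivals R K).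

Definition V_policy (policy : arrivals R K -> history N -> assortment N -> R) :
    \bar R :=
  (\int[P]_w (expected_reward (fun h _ S => policy (A w) h S) (A w))%:E)%E.

Definition V_OFF : \bar R := ereal_sup (V_policy @` is_offline_policy).

(** First-come-first-served *)

Definition static_offer (x : 'I_K -> assortment N -> R)
    (k : 'I_K) (S : assortment N) : R :=
  x k S + (if S == only_no_purchase N
           then 1 - \sum_(S' : assortment N) x k S' else 0).

Definition V_FCFS (x : 'I_K -> assortment N -> R) : \bar R :=
  (\int[P]_w (expected_reward (fun _ => static_offer x) (A w))%:E)%E.

End values.

(** Choice-based deterministic linear program *)

Definition Lambda (k : 'I_K) : R :=
  \int[lebesgue_measure]_(t in `[0, 1]) rate M k t.

Definition CDLP_objective (x : 'I_K -> assortment N -> R) : R :=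
  \sum_(k < K) \sum_(S : assortment N)
    Lambda k * x k S * \sum_(n in val S) choice_prob M k n S * reward n.

Definition CDLP_feasible (x : 'I_K -> assortment N -> R) : Prop :=
  [/\ (forall l : 'I_L,
         \sum_(k < K) Lambda k *
           \sum_(j < N | resource M j == l)
             \sum_(S : assortment N | Some j \in val S)
               x k S * choice_prob M k (Some j) S
         <= (capacity M l)%:R),
      (forall k, \sum_(S : assortment N) x k S <= 1) &
      (forall k S, 0 <= x k S)].

Definition V_CDLP : \bar R :=
  ereal_sup [set (CDLP_objective x)%:E | x in CDLP_feasible].

Definition CDLP_eps_optimal (eps : R) (x : 'I_K -> assortment N -> R) : Prop :=
  CDLP_feasible x /\ ((1 - eps)%:E * V_CDLP <= (CDLP_objective x)%:E)%E.

End dynamics.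

(* Main.v *)
Require Import Defs.
From mathcomp Require Import all_boot all_order all_algebra.
From mathcomp Require Import all_classical all_reals all_analysis.
From mathcomp Require Import measurable_realfun ring lra zify.

(* Both values are compared with the CDLP, and only the numbers N_k of type-k
   arrivals on [0,1] (independent, Poisson of mean Lambda_k) matter.

   FCFS: let D_l be the total number of requests for resource l.  If D_l <= C_l
   then every request for l is served, so the reward of a path is at least
   sum_j r_j (requests for j) 1(D_{l_j} <= C_{l_j}), which does not depend on the
   order of the arrivals.  Averaging over choices and counts, the number of
   requests for j is Poisson and size-biasing removes one of these requests:
   its term is r_j nu_j P(D < C_l), with nu_j the CDLP flow of j and D Poisson
   of mean at most C_l, and P(D < C_l) >= 1/e.

   Offline: the expected number of type-k customers to whom a policy offers S,
   divided by Lambda_k, is a feasible point of the CDLP whose objective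
   dominates the value of the policy. *)

Set Implicit Arguments.
Unset Strict Implicit.
Unset Printing Implicit Defensive.

Import Order.TTheory GRing.Theory Num.Theory.
Import numFieldNormedType.Exports.

Local Open Scope classical_set_scope.
Local Open Scope ring_scope.

(** * Expectation over choices for a static offer *)

Section dynamics.
Context (R : realType) (L N K : nat) (M : model R L N K).

Implicit Types (o : history N -> 'I_K -> assortment N -> R)
  (h : history N) (a : seq (R * 'I_K)) (s : seq 'I_K) (S : assortment N).

Lemma expectation_from_le o (f g : history N -> R) h a :
  (forall h k S, 0 <= o h k S) -> (forall h, f h <= g h) ->
  expectation_from M o f h a <= expectation_from M o g h a.
Proof.
move=> o0 fg; elim: a h => [|[t k] a IH] h //=.
apply: ler_sum => S _; apply: ler_wpM2l => //.
apply: ler_sum => n nS; apply: ler_wpM2l => //.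
exact: choice_ge0.
Qed.

Lemma expectation_from_sum o (I : Type) (r : seq I) (c : I -> R)
    (f : I -> history N -> R) h a :
  expectation_from M o (fun h => \sum_(i <- r) c i * f i h) h a =
  \sum_(i <- r) c i * expectation_from M o (f i) h a.
Proof.
elim: a h => [|[t k] a IH] h //=.
under eq_bigr do under eq_bigr do rewrite IH mulr_sumr.
under eq_bigr do rewrite exchange_big mulr_sumr.
rewrite exchange_big; apply: eq_bigr => i _ /=.
rewrite mulr_sumr; apply: eq_bigr => S _ /=.
rewrite [RHS]mulrCA; congr (_ * _); rewrite mulr_sumr; apply: eq_bigr => n _.
by rewrite mulrCA.
Qed.

(** Offers see arrivals only through their types here, so arrival times drop out; measurability then
    reduces to the countable set of type sequences. *)
Lemma expectation_from_types o (f : history N -> R) h a a' :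
  map snd a = map snd a' ->
  expectation_from M o f h a = expectation_from M o f h a'.
Proof.
elim: a a' h => [|[t k] a IH] [|[t' k'] a'] h //= [-> /IH E].
by apply: eq_bigr => S _; congr (_ * _); apply: eq_bigr => n _; rewrite E.
Qed.

Lemma expectation_from_ge0 o (f : history N -> R) h a :
  (forall h k S, 0 <= o h k S) -> (forall h, 0 <= f h) ->
  0 <= expectation_from M o f h a.
Proof.
move=> o0 f0; elim: a h => [|[t k] a IH] h //=.
apply: sumr_ge0 => S _; apply: mulr_ge0 => //.
apply: sumr_ge0 => n nS; apply: mulr_ge0 => //.
exact: choice_ge0.
Qed.

Lemma reward_from_ge0 c ns : 0 <= reward_from M c ns.
Proof.
elim: ns c => [|n ns IH] c //=; apply: addr_ge0 => //.
by case: ifP => // _; case: n => //= j; apply: price_ge0.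
Qed.

Definition uses (l : 'I_L) (n : option 'I_N) : bool :=
  if n is Some j then resource M j == l else false.

Lemma reward_from_ge (c : 'I_L -> nat) (ns : seq (option 'I_N)) :
  \sum_(j < N) price M j * ((count_mem (Some j) ns)%:R *
     (count (uses (resource M j)) ns <= c (resource M j))%:R)
  <= reward_from M c ns.
Proof.
elim: ns c => [|n ns IH] c /=; first by rewrite big1 // => j _; rewrite mul0r mulr0.
case: n => [j0|] /=; last by rewrite add0r; apply: IH.
case: ifPn => c0.
  apply: le_trans (lerD (lexx _) (IH _)).
  have -> : price M j0 = \sum_j price M j * (j0 == j)%:R.
    rewrite (bigD1 j0) //= eqxx mulr1 big1 ?addr0 // => j.
    by rewrite eq_sym => /negPf ->; rewrite mulr0.
  rewrite -big_split /=; apply: ler_sum => j _; rewrite -mulrDr.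
  apply: ler_wpM2l; first exact: price_ge0.
  (* The served request counts for at most 1, and the stock left after it covers the remaining
     demand whenever [c] covered the whole demand. *)
  rewrite natrD mulrDl; apply: lerD.
    by rewrite -[leRHS]mulr1 ler_wpM2l // lern1 leq_b1.
  apply: ler_wpM2l => //; rewrite ler_nat.
  have [<-|ne] := eqVneq (resource M j0) (resource M j); first by case: leqP => /=; lia.
  by rewrite add0n subn0.
(* Out of stock: for products on the resource of [j0] the demand is at least 1 while [c] is 0, so
   their indicators vanish; the other terms do not change. *)
rewrite add0r; apply: le_trans (IH _); apply: ler_sum => j _.
apply: ler_wpM2l; first exact: price_ge0.
have [e|ne] := eqVneq (resource M j0) (resource M j).
  by rewrite -e; case: (c _) c0 => // _; rewrite mulr0; apply: mulr_ge0.
rewrite add0n natrD; have -> // : (Some j0 == Some j) = false; last by rewrite add0r.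
by apply/eqP => -[e]; rewrite e eqxx in ne.
Qed.

(** * Generating polynomials of the demand for one resource *)

Section static.
Variables (x : 'I_K -> assortment N -> R) (j : 'I_N).
Let l := resource M j.

(** The indicator keeps the sum over all choices, so that it expands along the same double sum as
    [demand_poly]; [purchase_probE] gives the form used in the CDLP. *)
Definition purchase_prob k : R :=
  \sum_S x k S * \sum_(n in val S) choice_prob M k n S * (n == Some j)%:R.

(* Generating polynomial of the number of units of [l] demanded by one
   type-[k] customer. *)
Definition demand_poly k : {poly R} :=
  \sum_S x k S *: \sum_(n in val S) choice_prob M k n S *: 'X^(uses l n).

(* Generating polynomial of the demand for [l], weighted by the number of
   requests for [j], when [c k] customers of each type [k] arrive. *)
Definition request_poly (c : 'I_K -> nat) : {poly R} :=
  \sum_k0 (purchase_prob k0 * (c k0)%:R) *: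
     ('X * \prod_k demand_poly k ^+ (c k - (k == k0))).

Lemma count_mem_cons (k k0 : 'I_K) s :
  count_mem k (k0 :: s) = ((k == k0) + count_mem k s)%N.
Proof. by rewrite /= eq_sym. Qed.

Lemma prod_demand_cons k0 s :
  \prod_k demand_poly k ^+ count_mem k (k0 :: s) =
  demand_poly k0 * \prod_k demand_poly k ^+ count_mem k s.
Proof.
under eq_bigr do rewrite count_mem_cons exprD.
rewrite big_split /= (bigD1 k0) //= eqxx expr1 big1 ?mulr1 // => k /negPf ->.
by rewrite expr0.
Qed.

(** A product rule: the distinguished request for [j] comes either from the first customer or from
    one of the others, in which case the first customer only adds to the demand. *)
Lemma request_poly_cons k0 s :
  request_poly (fun k => count_mem k (k0 :: s)) =
  purchase_prob k0 *: ('X * \prod_k demand_poly k ^+ count_mem k s) +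
  demand_poly k0 * request_poly (fun k => count_mem k s).
Proof.
rewrite /request_poly mulr_sumr.
have -> : purchase_prob k0 *: ('X * \prod_k demand_poly k ^+ count_mem k s) =
  \sum_k1 (purchase_prob k1 * (k1 == k0)%:R) *:
     ('X * \prod_k demand_poly k ^+ count_mem k s).
  rewrite [RHS](bigD1 k0) //= eqxx mulr1 [X in _ + X]big1 ?addr0 // => k /negPf ->.
  by rewrite mulr0 scale0r.
rewrite -big_split; apply: eq_bigr => k1 _ /=.
rewrite [in LHS]eq_sym natrD mulrDr scalerDl; congr (_ + _).
  have [->|_] := eqVneq k1 k0; last by rewrite mulr0 !scale0r.
  congr (_ *: (_ * _)); apply: eq_bigr => k _; congr (_ ^+ _).
  by rewrite eq_sym addKn.
(* With no customer of type [k1] in [s] both sides vanish; otherwise the truncated subtraction in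
   the exponent is a true one. *)
have [->|c0] := posnP (count_mem k1 s); first by rewrite mulr0 !scale0r mulr0.
rewrite -scalerAr mulrCA; congr (_ *: (_ * _)).
rewrite (bigD1 k0) //= [in RHS](bigD1 k0) //= mulrA eqxx add1n -exprS; congr (_ * _).
  congr (_ ^+ _).
  case: eqP => [->|_]; last by rewrite !subn0.
  by rewrite !subn1 /= prednK.
by apply: eq_bigr => k /negPf ne; rewrite eq_sym ne add0n.
Qed.

(** Past demand shifts the degree by a monomial. Past requests for [j] weight the whole future
    demand, and future ones are counted by [request_poly]. Keeping [h] general lets the induction on
    [a] append one choice at a time. *)
Lemma expectation_requests (d : nat) h a :
  expectation_from M (fun _ => x)
    (fun h => (count_mem (Some j) (map snd h))%:R *
              (count (uses l) (map snd h) == d)%:R) h a =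
  ('X^(count (uses l) (map snd h)) *
    ((count_mem (Some j) (map snd h))%:R *:
        (\prod_k demand_poly k ^+ count_mem k (map snd a)) +
     request_poly (fun k => count_mem k (map snd a))))`_d.
Proof.
elim: a h => [|[t k0] a IH] h.
  rewrite /= big1 => [|k _]; last by rewrite expr0.
  rewrite /request_poly big1 ?addr0; last by move=> k _; rewrite mulr0 scale0r.
  by rewrite -scalerAr mulr1 coefZ coefXn eq_sym.
rewrite [map snd (_ :: _)]/= request_poly_cons prod_demand_cons.
set G := \prod_k _; set U := request_poly _; set D := count _ _; set c := count_mem _ _.
rewrite [LHS]/=.
have E : 'X^D * (c%:R *: (demand_poly k0 * G) +
    (purchase_prob k0 *: ('X * G) + demand_poly k0 * U)) =
    \sum_S x k0 S *: \sum_(n in val S) choice_prob M k0 n S *: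
      ('X^(D + uses l n) * ((c + (n == Some j))%:R *: G + U)).
  rewrite /purchase_prob /demand_poly.
  rewrite !mulr_suml scaler_suml scaler_sumr -!big_split mulr_sumr /=.
  apply: eq_bigr => S _.
  rewrite -!scalerAl (scalerA _ (x k0 S)) [c%:R * _]mulrC -scalerA -[(x k0 S * _) *: _]scalerA.
  rewrite -!scalerDr -scalerAr; congr (_ *: _).
  rewrite !mulr_suml scaler_suml scaler_sumr -!big_split mulr_sumr /=.
  apply: eq_bigr => n _.
  rewrite -!scalerAl (scalerA _ (choice_prob _ _ _ _)) [c%:R * _]mulrC -scalerA.
  rewrite -[(choice_prob _ _ _ _ * _) *: _]scalerA.
  rewrite -!scalerDr -scalerAr; congr (_ *: _).
  rewrite exprD -mulrA; congr (_ * _).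
  rewrite natrD scalerDl -addrA mulrDr -scalerAr; congr (_ + _).
  rewrite mulrDr; congr (_ + _).
  case: eqP => [->|_]; last by rewrite !scale0r mulr0.
  by rewrite /= /l eqxx !scale1r expr1.
rewrite E coef_sum; apply: eq_bigr => S _; rewrite coefZ; congr (_ * _).
rewrite coef_sum; apply: eq_bigr => n _; rewrite coefZ; congr (_ * _).
by rewrite IH map_rcons -cats1 !count_cat /= !addn0.
Qed.

Lemma expectation_requests_le (C : nat) a :
  expectation_from M (fun _ => x)
    (fun h => (count_mem (Some j) (map snd h))%:R *
              (count (uses l) (map snd h) <= C)%:R) [::] a =
  \sum_(d < C.+1) (request_poly (fun k => count_mem k (map snd a)))`_d.
Proof.
pose f (d : nat) h : R := (count_mem (Some j) (map snd h))%:R *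
  (count (uses l) (map snd h) == d)%:R.
transitivity (expectation_from M (fun _ => x)
   (fun h => \sum_(d <- index_enum 'I_C.+1) 1 * f d h) [::] a).
  congr expectation_from; apply/funext => h.
  under eq_bigr do rewrite mul1r; rewrite -mulr_sumr; congr (_ * _).
  set D := count _ _.
  have [DC|DC] := leqP D C.
    have DC' : (D < C.+1)%N by [].
    rewrite (bigD1 (Ordinal DC')) //= eqxx big1 ?addr0 // => d.
    by rewrite -val_eqE /= eq_sym => /negPf ->.
  rewrite big1 // => d _; case: eqP => // e.
  by have := ltn_ord d; rewrite -e ltnS leqNgt DC.
rewrite expectation_from_sum; apply: eq_bigr => d _.
by rewrite mul1r expectation_requests /= mul1r scale0r add0r.
Qed.

End static.

Lemma expected_reward_ge (x : 'I_K -> assortment N -> R) a :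
  (forall k S, 0 <= x k S) ->
  \sum_(j < N) price M j * \sum_(d < (capacity M (resource M j)).+1)
     (request_poly x j (fun k => count_mem k (map snd a)))`_d
  <= expected_reward M (fun _ => x) a.
Proof.
move=> x0; rewrite /expected_reward.
under eq_bigr do rewrite -expectation_requests_le.
rewrite -expectation_from_sum; apply: expectation_from_le => // h.
exact: reward_from_ge.
Qed.

End dynamics.

(** * Poisson weights *)

Section poisson_weights.
Context (R : realType).
Implicit Types (m p z : R) (n d C : nat).

(** At mean 0 the convention 0^0 = 1 makes this the Dirac mass at 0, in agreement with
    [poisson_prob]. *)
Definition poisson_weight m n : R := m ^+ n / n`!%:R * expR (- m).

Lemma poisson_weight_ge0 m n : 0 <= m -> 0 <= poisson_weight m n.
Proof. by move=> m0; rewrite !mulr_ge0 ?expR_ge0 ?exprn_ge0 ?invr_ge0. Qed.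

Lemma poisson_weightS m n :
  n.+1%:R * poisson_weight m n.+1 = m * poisson_weight m n.
Proof.
rewrite /poisson_weight factS natrM exprS.
by field; rewrite nat1r !pnatr_eq0 -!lt0n fact_gt0.
Qed.

Lemma is_derive_poisson_weight m n :
  is_derive m 1 (poisson_weight ^~ n)
    ((if n is n'.+1 then poisson_weight m n' else 0) - poisson_weight m n).
Proof.
have -> : poisson_weight ^~ n =
    (id ^+ n : R -> R) * (n`!%:R^-1 *: (expR \o -%R) : R -> R).
  apply/funext => z; rewrite /poisson_weight fctE /= /GRing.scale /= mulrA.
  by congr (_ * _ * _); elim: n => [|n IH] //; rewrite !exprS IH.
apply: is_derive_eq.
have E z k : (id ^+ k : R -> R) z = z ^+ k.
  by elim: k => [|k IH] //; rewrite !exprS -IH.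
rewrite /= /GRing.scale /= /GRing.scale /= E.
case: n => [|n]; rewrite /poisson_weight; first by rewrite expr0 fact0; field.
rewrite factS natrM exprS /=.
by field; rewrite nat1r !pnatr_eq0 -!lt0n fact_gt0.
Qed.

(** The derivatives of the individual weights telescope. *)
Lemma is_derive_poisson_cdf m C :
  is_derive m 1 (fun z => \sum_(d < C.+1) poisson_weight z d)
    (- poisson_weight m C).
Proof.
have -> : (fun z => \sum_(d < C.+1) poisson_weight z d) =
    \sum_(d < C.+1) (poisson_weight ^~ d).
  by apply/funext => z; rewrite fct_sumE.
have /is_derive_eq := is_derive_sum (fun d : 'I_C.+1 => is_derive_poisson_weight m d).
apply.
elim: C => [|C IH]; first by rewrite big_ord1 add0r.
by rewrite big_ord_recr /= IH; ring.
Qed.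

Lemma poisson_cdf_MVT C m m' : m <= m' ->
  exists2 c, m <= c <= m' &
    \sum_(d < C.+1) poisson_weight m' d - \sum_(d < C.+1) poisson_weight m d =
    - poisson_weight c C * (m' - m).
Proof.
move=> mm'.
have [||c] := @MVT_segment R (fun z => \sum_(d < C.+1) poisson_weight z d)
  (fun z => - poisson_weight z C) m m' mm'.
- by move=> z _; apply: is_derive_poisson_cdf.
- apply: derivable_within_continuous => z _.
  by have [] := is_derive_poisson_cdf z C.
by rewrite in_itv /= => cI E; exists c.
Qed.

(** For n > 0 put u = (z - n) / n. Then 1 + u <= e^u gives z <= n e^u, and the n-th power of this is
    the claim, because e^(-n) = e^(-z) e^(u n). *)
Lemma poisson_weight_mode n z : n%:R <= z ->
  poisson_weight z n <= poisson_weight n%:R n.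
Proof.
case: n => [|n] nz.
  rewrite /poisson_weight !expr0 oppr0 expR0 mulr1 -[leRHS]mulr1 ler_wpM2l //.
  by rewrite -expR0 ler_expR oppr_le0.
set a : R := n.+1%:R in nz *; have a0 : 0 < a by rewrite ltr0n.
rewrite /poisson_weight mulrAC [leRHS]mulrAC ler_wpM2r ?invr_ge0 //.
have -> : - a = - z + (z - a) / a * a by field; rewrite gt_eqF.
rewrite expRD mulrCA [leLHS]mulrC ler_wpM2l ?expR_ge0 // expRM_natr.
rewrite -exprMn ler_pXn2r ?nnegrE //; last first.
- by rewrite mulr_ge0 ?expR_ge0 // ltW.
- exact: le_trans (ltW a0) nz.
have := ler_wpM2l (ltW a0) (expR_ge1Dx ((z - a) / a)).
by have -> : a * (1 + (z - a) / a) = z by field; rewrite gt_eqF.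
Qed.

(* The increments of [C |-> P(Poisson C <= C - 1)] are nonnegative: passing from
   [C] to [C+1] adds the mode of [t |-> t^C e^-t / C!] and subtracts its
   integral over [C, C+1]. *)
Lemma poisson_cdf_ge C m : m <= C.+1%:R -> 0 <= m ->
  (expR 1)^-1 <= \sum_(d < C.+1) poisson_weight m d.
Proof.
move=> mC m0.
have [c /andP[mc cC] E] := poisson_cdf_MVT C mC.
(* The distribution function decreases in the mean, so the worst case is [m] equal to [C.+1]; the
   induction on [C] starts from e^(-1). *)
apply: (@le_trans _ _ (\sum_(d < C.+1) poisson_weight C.+1%:R d)); last first.
  rewrite -subr_le0 E mulNr oppr_le0 mulr_ge0 ?subr_ge0 //.
  exact: poisson_weight_ge0 (le_trans m0 mc).
elim: {m m0 mC c mc cC E} C => [|C IH].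
  by rewrite big_ord1 /poisson_weight expr0 fact0 invr1 !mul1r expRN.
apply: le_trans IH _.
have CC : C.+1%:R <= C.+2%:R :> R by rewrite ler_nat.
have [c /andP[mc cC]] := poisson_cdf_MVT C.+1 CC.
rewrite -natrB // subSnn mulr1 => E.
rewrite -subr_ge0.
have -> : \sum_(d < C.+2) poisson_weight C.+2%:R d =
   \sum_(d < C.+2) poisson_weight C.+1%:R d - poisson_weight c C.+1.
  by rewrite -E; ring.
rewrite big_ord_recr /=.
have := poisson_weight_mode mc; lra.
Qed.

(** By [poisson_weightS] the truncated mean is [m] times a value of the distribution function, which
    decreases in the mean from its value 1 at mean 0. *)
Lemma poisson_mean_le b m : 0 <= m ->
  \sum_(n < b) n%:R * poisson_weight m n <= m.
Proof.
move=> m0; case: b => [|[|b]]; rewrite ?big_ord0 ?big_ord1 ?mul0r //.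
rewrite big_ord_recl mul0r add0r.
under eq_bigr do rewrite lift0 poisson_weightS.
rewrite -mulr_sumr -[leRHS]mulr1 ler_wpM2l //.
have [c /andP[c0 _]] := poisson_cdf_MVT b m0.
have -> : \sum_(i < b.+1) poisson_weight 0 i = 1 :> R.
  rewrite big_ord_recl /poisson_weight oppr0 expR0 !mulr1 expr0 invr1.
  by rewrite mulr1 big1 ?addr0 // => i _; rewrite expr0n !mul0r.
move=> E; rewrite -subr_le0 E mulNr oppr_le0 subr0 mulr_ge0 //.
exact: poisson_weight_ge0.
Qed.

Lemma exp_series_cvg z : \sum_(i < n) z ^+ i / i`!%:R @[n --> \oo] --> expR z.
Proof.
have := @is_cvg_series_exp_coeff R z.
by rewrite seriesEord => /cvg_ex[l hl]; rewrite /expR seriesEord; apply/cvg_ex; exists l.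
Qed.

Lemma coef_linear_exp p n d :
  (((1 - p)%:P + p%:P * 'X) ^+ n)`_d = (1 - p) ^+ (n - d) * p ^+ d * 'C(n, d)%:R.
Proof.
rewrite exprDn coef_sum mulr_natr.
under eq_bigr do rewrite coefMn exprMn -!polyC_exp coefCM coefCM coefXn.
have [dn|nd] := leqP d n.
  have dn' : (d < n.+1)%N by [].
  rewrite (bigD1 (Ordinal dn')) //= eqxx big1 ?addr0 ?mulr1 // => i.
  by rewrite -val_eqE /= eq_sym => /negPf ->; rewrite !(mulr0, mul0rn).
rewrite bin_small // mulr0n big1 // => i _; case: eqP => [e|]; last by rewrite !(mulr0, mul0rn).
by have := ltn_ord i; rewrite -e ltnS leqNgt nd.
Qed.

(* Thinning: a Poisson(m) number of customers, each counted with probability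
   [p], produces a Poisson(m p) count. *)
Lemma cvg_thinning m p d :
  (\sum_(n < b) poisson_weight m n *: ((1 - p)%:P + p%:P * 'X) ^+ n)`_d @[b --> \oo]
    --> poisson_weight (m * p) d.
Proof.
(* The terms with n < d have no coefficient of degree d; dropping them leaves a constant times a
   partial sum of the series of exp(m (1 - p)). *)
rewrite -(cvg_shiftn d) /=.
have E b : (\sum_(n < b + d)
    poisson_weight m n *: ((1 - p)%:P + p%:P * 'X) ^+ n)`_d =
    expR (- m) * ((m * p) ^+ d / d`!%:R) *
     \sum_(i < b) (m * (1 - p)) ^+ i / i`!%:R.
  rewrite coef_sum addnC big_split_ord /= big1 ?add0r => [|i _]; last first.
    by rewrite coefZ coef_linear_exp bin_small // !mulr0.
  rewrite mulr_sumr; apply: eq_bigr => i _ /=.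
  rewrite coefZ coef_linear_exp addKn /poisson_weight exprD !exprMn.
  have : ('C(d + i, d)%:R * (d`!%:R * i`!%:R) = (d + i)`!%:R :> R).
    by rewrite -!natrM -(bin_fact (leq_addr i d)) addKn.
  have f1 : d`!%:R != 0 :> R by rewrite pnatr_eq0 -lt0n fact_gt0.
  have f2 : i`!%:R != 0 :> R by rewrite pnatr_eq0 -lt0n fact_gt0.
  have f3 : (d + i)`!%:R != 0 :> R by rewrite pnatr_eq0 -lt0n fact_gt0.
  move=> B; have -> : 'C(d + i, d)%:R = (d + i)`!%:R / (d`!%:R * i`!%:R) :> R.
    by rewrite -B; field; rewrite f1 f2.
  by field; rewrite f1 f2 f3.
under eq_fun do rewrite E.
have -> : poisson_weight (m * p) d =
   expR (- m) * ((m * p) ^+ d / d`!%:R) * expR (m * (1 - p)).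
  rewrite /poisson_weight (_ : - (m * p) = - m + m * (1 - p)); last by ring.
  by rewrite expRD mulrA [_ * expR (- m)]mulrC.
apply: cvgMr; exact: exp_series_cvg.
Qed.

(* Size-biasing a Poisson count amounts to adding one customer: the exponent
   [n - 1] removes it, and the factor [m] is the mean. *)
Lemma cvg_size_biased_thinning m p d :
  (\sum_(n < b) (poisson_weight m n * n%:R) *: ((1 - p)%:P + p%:P * 'X) ^+ (n - 1))`_d
    @[b --> \oo] --> m * poisson_weight (m * p) d.
Proof.
rewrite -cvg_shiftS /=.
have E b : \sum_(n < b.+1)
    (poisson_weight m n * n%:R) *: ((1 - p)%:P + p%:P * 'X) ^+ (n - 1) =
    m%:P * \sum_(n < b) poisson_weight m n *: ((1 - p)%:P + p%:P * 'X) ^+ n.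
  rewrite big_ord_recl mulr0 scale0r add0r mulr_sumr; apply: eq_bigr => i _.
  by rewrite lift0 [RHS]mul_polyC scalerA -poisson_weightS mulrC subn1.
under eq_fun do rewrite E coefCM.
apply: cvgMr; exact: cvg_thinning.
Qed.

(** Convolution of two Poisson laws, by the binomial theorem. *)
Lemma poisson_weightD m m' d :
  \sum_(i < d.+1) poisson_weight m i * poisson_weight m' (d - i) =
  poisson_weight (m + m') d.
Proof.
rewrite /poisson_weight addrC exprDn opprD expRD !mulr_suml.
apply: eq_bigr => i _; rewrite -mulr_natr.
have id : (i <= d)%N by rewrite -ltnS.
have := bin_fact id; move/(congr1 (fun n => n%:R : R)); rewrite !natrM => <-.
have f1 : i`!%:R != 0 :> R by rewrite pnatr_eq0 -lt0n fact_gt0.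
have f2 : (d - i)`!%:R != 0 :> R by rewrite pnatr_eq0 -lt0n fact_gt0.
have f3 : 'C(d, i)%:R != 0 :> R by rewrite pnatr_eq0 -lt0n bin_gt0.
by field; rewrite f1 f2 f3.
Qed.

(** A coefficient of a product is a finite convolution, so limits pass through it and the Poisson
    means add up. The constants [c] carry the factor produced by size-biasing. *)
Lemma cvg_prod_poisson (I : Type) (r : seq I) (c m : I -> R)
    (P : I -> nat -> {poly R}) d :
  (forall i d, (P i b)`_d @[b --> \oo] --> c i * poisson_weight (m i) d) ->
  (\prod_(i <- r) P i b)`_d @[b --> \oo] -->
    (\prod_(i <- r) c i) * poisson_weight (\sum_(i <- r) m i) d.
Proof.
move=> HP; elim: r d => [|i r IH] d.
  rewrite !big_nil; under eq_fun do rewrite big_nil.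
  rewrite mul1r /poisson_weight oppr0 expR0 mulr1 coef1.
  have -> : 0 ^+ d / d`!%:R = (d == 0)%:R :> R.
    by case: d => [|d]; rewrite ?invr1 ?mulr1 // expr0n mul0r.
  exact: cvg_cst.
under eq_fun do rewrite big_cons coefM.
rewrite !big_cons -poisson_weightD mulr_sumr.
apply: cvg_big => [|k _]; first exact: add_continuous.
rewrite mulrACA; apply: cvgM; [exact: HP|exact: IH].
Qed.

End poisson_weights.

(** * FCFS demand against the CDLP *)

Section poisson_demand.
Context (R : realType) (L N K : nat) (M : model R L N K).
Implicit Types (x : 'I_K -> assortment N -> R) (j : 'I_N) (l : 'I_L) (k : 'I_K).

Definition demand_prob x l k : R :=
  \sum_(j < N | resource M j == l) purchase_prob M x j k.

Lemma purchase_probE x j k :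
  purchase_prob M x j k =
  \sum_(S : assortment N | Some j \in val S) x k S * choice_prob M k (Some j) S.
Proof.
rewrite /purchase_prob [RHS]big_mkcond; apply: eq_bigr => S _.
case: ifPn => jS.
  rewrite (bigD1 (Some j)) //= eqxx mulr1 big1 ?addr0 // => n /andP[_ /negPf ->].
  by rewrite mulr0.
rewrite big1 ?mulr0 // => n nS; case: eqP => [e|]; last by rewrite mulr0.
by rewrite e (negPf jS) in nS.
Qed.

Lemma purchase_prob_static x j k :
  purchase_prob M (static_offer x) j k = purchase_prob M x j k.
Proof.
rewrite !purchase_probE; apply: eq_bigr => S jS; rewrite /static_offer.
case: eqP => [e|_]; last by rewrite addr0.
by move: jS; rewrite e inE.
Qed.

Lemma static_offer_ge0 x : (forall k S, 0 <= x k S) ->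
  (forall k, \sum_S x k S <= 1) -> forall k S, 0 <= static_offer x k S.
Proof.
move=> x0 x1 k S; rewrite /static_offer addr_ge0 //.
by case: ifP => // _; rewrite subr_ge0.
Qed.

Lemma static_offer_sum1 x k : \sum_S static_offer x k S = 1.
Proof.
by rewrite /static_offer big_split /= -big_mkcond big_pred1_eq subrKC.
Qed.

Lemma purchase_prob_ge0 x j k : (forall k S, 0 <= x k S) ->
  0 <= purchase_prob M x j k.
Proof.
move=> x0; rewrite purchase_probE sumr_ge0 // => S jS.
by rewrite mulr_ge0 // choice_ge0.
Qed.

Lemma uses_sum l (n : option 'I_N) :
  (uses M l n)%:R = \sum_(j < N | resource M j == l) (n == Some j)%:R :> R.
Proof.
case: n => [j0|] /=; last by rewrite big1.
rewrite (eq_bigr (fun j => (j == j0)%:R)) => [|j _]; last first.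
  by rewrite eq_sym; congr ((_ : bool)%:R); apply/eqP/eqP => [[->]|->].
case: eqP => [e|ne].
  rewrite (bigD1 j0) ?e //= eqxx big1 ?addr0 // => j /andP[_ /negPf ->] //.
rewrite big1 // => j /eqP e; case: eqP => // e'; by rewrite e' in e.
Qed.

Lemma demand_probE x l k : demand_prob x l k =
  \sum_S x k S * \sum_(n in val S) choice_prob M k n S * (uses M l n)%:R.
Proof.
rewrite /demand_prob exchange_big; apply: eq_bigr => S _.
rewrite -mulr_sumr; congr (_ * _); rewrite exchange_big; apply: eq_bigr => n _.
by rewrite -mulr_sumr uses_sum.
Qed.

(** A customer demands 0 or 1 unit, so the polynomial is linear. Since offers and choices both have
    total mass 1, it is the average of 1 + (X - 1) over the choices that use the resource. *)
Lemma demand_polyE x j k : \sum_S x k S = 1 ->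
  demand_poly M x j k = (1 - demand_prob x (resource M j) k)%:P +
                        (demand_prob x (resource M j) k)%:P * 'X.
Proof.
move=> x1; set l := resource M j.
rewrite demand_probE.
have -> (q : R) : (1 - q)%:P + q%:P * 'X = 1 + q *: ('X - 1).
  by rewrite polyCB -mul_polyC; ring.
rewrite scaler_suml.
rewrite [X in _ = X + _](_ : 1 = \sum_S x k S *: (1 : {poly R})); last first.
  by rewrite -scaler_suml x1 scale1r.
rewrite -big_split; apply: eq_bigr => S _ /=; rewrite -scalerA -scalerDr.
congr (_ *: _); rewrite scaler_suml.
rewrite [X in _ = X + _](_ : 1 =
    \sum_(n in val S) choice_prob M k n S *: (1 : {poly R})); last first.
  by rewrite -scaler_suml choice_sum1 scale1r.
rewrite -big_split; apply: eq_bigr => n _ /=; rewrite -scalerA -scalerDr.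
congr (_ *: _); case: uses; first by rewrite expr1 scale1r subrKC.
by rewrite scale0r addr0 expr0.
Qed.

Definition mean_demand (m : 'I_K -> R) x l : R := \sum_k m k * demand_prob x l k.

(** Summing over a box of counts factors the sum over the types: the type issuing the distinguished
    request is size-biased, the others are merely thinned. That request itself contributes the
    factor X, hence the degree [d.+1]. *)
Lemma cvg_request_poly (m : 'I_K -> R) x j d :
  (forall k, \sum_S x k S = 1) ->
  (\sum_(c : {ffun 'I_K -> 'I_b}) (\prod_k poisson_weight (m k) (c k)) *:
      request_poly M x j (fun k => c k))`_d.+1 @[b --> \oo] -->
  (\sum_k m k * purchase_prob M x j k) *
    poisson_weight (mean_demand m x (resource M j)) d.
Proof.
move=> x1; set l := resource M j.
pose F (k0 k : 'I_K) (n : nat) : {poly R} :=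
  (poisson_weight (m k) n * (if k == k0 then n%:R else 1)) *:
    demand_poly M x j k ^+ (n - (k == k0)).
have E b : \sum_(c : {ffun 'I_K -> 'I_b}) (\prod_k poisson_weight (m k) (c k)) *:
      request_poly M x j (fun k => c k) =
    \sum_k0 purchase_prob M x j k0 *: ('X * \prod_k \sum_(n < b) F k0 k n).
  under eq_bigr do rewrite /request_poly scaler_sumr.
  rewrite exchange_big; apply: eq_bigr => k0 _ /=.
  rewrite bigA_distr_bigA /= mulr_sumr scaler_sumr; apply: eq_bigr => c _.
  rewrite /F [in RHS]scaler_prod [in RHS]big_split /= -[in RHS]big_mkcond [in RHS]big_pred1_eq.
  by rewrite -scalerAr !scalerA; congr (_ *: _); ring.
under eq_fun do rewrite E coef_sum.
rewrite mulr_suml; apply: cvg_big => [|k0 _]; first exact: add_continuous.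
under eq_fun do rewrite coefZ coefXM /=.
rewrite mulrAC mulrC; apply: cvgMr.
(* The mean of the size-biased type is written as a product over all types, to serve as the
   constants of [cvg_prod_poisson]. *)
have -> : m k0 = \prod_k (if k == k0 then m k else 1).
  by rewrite -big_mkcond big_pred1_eq.
apply: cvg_prod_poisson => k i.
rewrite /F demand_polyE //; case: eqP => _ /=.
  exact: cvg_size_biased_thinning.
rewrite mul1r; under eq_fun do under eq_bigr do rewrite mulr1 subn0.
exact: cvg_thinning.
Qed.

Lemma CDLP_objectiveE x :
  CDLP_objective M x =
  \sum_(j < N) price M j * \sum_k Lambda M k * purchase_prob M x j k.
Proof.
rewrite /CDLP_objective.
under [RHS]eq_bigr do rewrite mulr_sumr.
rewrite [RHS]exchange_big; apply: eq_bigr => k _ /=.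
under [RHS]eq_bigr do rewrite /purchase_prob !mulr_sumr.
rewrite [RHS]exchange_big; apply: eq_bigr => S _ /=.
under [RHS]eq_bigr do rewrite !mulr_sumr.
rewrite [RHS]exchange_big mulr_sumr; apply: eq_bigr => n nS /=.
case: n {nS} => [j|] /=; last by rewrite !mulr0 big1 // => j _; rewrite !mulr0.
rewrite (bigD1 j) //= eqxx mulr1 [X in _ = _ + X]big1; first by ring.
by move=> i; rewrite eq_sym => ne; case: eqP => [[e]|_]; [rewrite e eqxx in ne|rewrite !mulr0].
Qed.

Lemma Lambda_ge0 k : 0 <= Lambda M k.
Proof.
rewrite /Lambda; apply: Rintegral_ge0 => t; rewrite /= in_itv /=.
exact: rate_ge0.
Qed.

Lemma mean_demand_le x l : CDLP_feasible M x ->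
  mean_demand (Lambda M) (static_offer x) l <= (capacity M l)%:R.
Proof.
move=> [/(_ l) cap _ _]; apply: le_trans cap.
apply: ler_sum => k _; apply: ler_wpM2l; first exact: Lambda_ge0.
apply: ler_sum => j _; by rewrite purchase_prob_static purchase_probE.
Qed.

Lemma CDLP_objective_le_sales x : CDLP_feasible M x ->
  (expR 1)^-1 * CDLP_objective M x <=
  \sum_(j < N) price M j * \sum_(d < capacity M (resource M j))
    (\sum_k Lambda M k * purchase_prob M (static_offer x) j k) *
    poisson_weight (mean_demand (Lambda M) (static_offer x) (resource M j)) d.
Proof.
move=> feas; have [_ x1 x0] := feas.
rewrite CDLP_objectiveE mulr_sumr; apply: ler_sum => j _; rewrite mulrCA.
apply: ler_wpM2l; first exact: price_ge0.
rewrite -mulr_sumr.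
under [in leRHS]eq_bigr do rewrite purchase_prob_static.
set q := \sum_k _.
have q0 : 0 <= q.
  by apply: sumr_ge0 => k _; rewrite mulr_ge0 ?Lambda_ge0 ?purchase_prob_ge0.
have qmu : q <= mean_demand (Lambda M) (static_offer x) (resource M j).
  apply: ler_sum => k _; apply: ler_wpM2l; first exact: Lambda_ge0.
  rewrite /demand_prob (bigD1 j) //= purchase_prob_static lerDl.
  by apply: sumr_ge0 => i _; rewrite purchase_prob_ge0 //; apply: static_offer_ge0.
have := mean_demand_le (resource M j) feas.
set mu := mean_demand _ _ _ in qmu *.
(* Without capacity the flow [q] is at most [mu], hence 0, and both sides vanish; otherwise
   [poisson_cdf_ge] applies. *)
case: (capacity _ _) => [|C] muC.
  have -> : q = 0 by apply/eqP; rewrite eq_le q0 (le_trans qmu muC).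
  by rewrite !(mulr0, mul0r).
rewrite mulrC; apply: ler_wpM2l => //; apply: poisson_cdf_ge => //.
exact: le_trans qmu.
Qed.

End poisson_demand.

(** * Offline offers *)

Section offers.
Context (R : realType) (L N K : nat) (M : model R L N K).

(* Expected number of type-[k] customers, among those of types [s] arriving after
   the history [h], to whom [S] is offered. *)
Fixpoint expected_offers (o : history N -> 'I_K -> assortment N -> R)
    (k : 'I_K) (S : assortment N) (h : history N) (s : seq 'I_K) : R :=
  if s is k0 :: s' then
    (k0 == k)%:R * o h k0 S +
    \sum_(S' : assortment N) o h k0 S' *
      \sum_(n in val S') choice_prob M k0 n S' *
        expected_offers o k S (rcons h (S', n)) s'
  else 0.

Variable o : history N -> 'I_K -> assortment N -> R.
Hypothesis o_ge0 : forall h k S, 0 <= o h k S.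
Hypothesis o_sum1 : forall h k, \sum_S o h k S = 1.

Lemma expected_offers_ge0 k S h s : 0 <= expected_offers o k S h s.
Proof.
elim: s h => [|k0 s IH] h //=; apply: addr_ge0; first by rewrite mulr_ge0.
apply: sumr_ge0 => S' _; apply: mulr_ge0 => //.
by apply: sumr_ge0 => n nS; rewrite mulr_ge0 // choice_ge0.
Qed.

(** Lets a constant be spread over one offer and choice, for termwise comparison in the inductions
    below. *)
Lemma offer_choice_sum1 h k (r : R) :
  \sum_S o h k S * \sum_(n in val S) choice_prob M k n S * r = r.
Proof.
under eq_bigr do rewrite -mulr_suml choice_sum1 mul1r.
by rewrite -mulr_suml o_sum1 mul1r.
Qed.

Lemma sum_expected_offers k h s :
  \sum_S expected_offers o k S h s = (count_mem k s)%:R.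
Proof.
elim: s h => [|k0 s IH] h /=; first by rewrite big1.
rewrite big_split /= -mulr_sumr o_sum1 mulr1 natrD; congr (_ + _).
rewrite exchange_big /= -[RHS](offer_choice_sum1 h k0).
apply: eq_bigr => S _; rewrite -mulr_sumr; congr (_ * _).
rewrite exchange_big; apply: eq_bigr => n _.
by rewrite -mulr_sumr IH.
Qed.

Definition mean_choice (g : option 'I_N -> R) (k : 'I_K) (S : assortment N) : R :=
  \sum_(n in val S) choice_prob M k n S * g n.

(* Expected total of [g] over the choices made, regrouped by offered assortment. *)
Definition offers_value (g : option 'I_N -> R) h s : R :=
  \sum_k \sum_S expected_offers o k S h s * mean_choice g k S.

Lemma offers_value_nil g h : offers_value g h [::] = 0.
Proof. by rewrite /offers_value big1 // => k _; rewrite big1 // => S _; rewrite mul0r. Qed.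

(** Turns the sum regrouped by assortment back into a recursion along the arrivals, the form needed
    for comparison with [expectation_from] and with the inventory. *)
Lemma offers_value_cons g h k0 s :
  offers_value g h (k0 :: s) =
  \sum_S o h k0 S * \sum_(n in val S) choice_prob M k0 n S *
    (g n + offers_value g (rcons h (S, n)) s).
Proof.
rewrite /offers_value /=.
under eq_bigr do under eq_bigr do rewrite mulrDl.
under eq_bigr do rewrite big_split /=.
under [RHS]eq_bigr do under eq_bigr do rewrite mulrDr.
under [RHS]eq_bigr do rewrite big_split /= mulrDr.
rewrite !big_split /=; congr (_ + _).
  rewrite (bigD1 k0) //= [X in _ + X]big1 ?addr0 => [|k]; last first.
    by rewrite eq_sym => /negPf ->; rewrite big1 // => S _; rewrite !mul0r.
  by apply: eq_bigr => S _; rewrite eqxx mul1r.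
under eq_bigr do under eq_bigr do rewrite mulr_suml.
under eq_bigr do rewrite exchange_big /=.
rewrite exchange_big; apply: eq_bigr => S' _ /=.
under eq_bigr do under eq_bigr do rewrite -mulrA.
under eq_bigr do rewrite -mulr_sumr.
rewrite -mulr_sumr; congr (_ * _).
transitivity (\sum_k \sum_(n in val S') \sum_S choice_prob M k0 n S' *
    expected_offers o k S (rcons h (S', n)) s * mean_choice g k S).
  apply: eq_bigr => k _; rewrite exchange_big; apply: eq_bigr => S _ /=.
  by rewrite mulr_suml.
rewrite exchange_big; apply: eq_bigr => n _ /=.
rewrite mulr_sumr; apply: eq_bigr => k _.
by rewrite mulr_sumr; apply: eq_bigr => S _; rewrite mulrA.
Qed.

Lemma reward_ge0 n : 0 <= reward M n.
Proof. by case: n => //= j; apply: price_ge0. Qed.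

Lemma reward_from_rcons c ns n :
  reward_from M c (rcons ns n) <= reward_from M c ns + reward M n.
Proof.
elim: ns c => [|n0 ns IH] c /=; last by rewrite -addrA lerD2l.
by rewrite addr0 add0r; case: ifP => // _; apply: reward_ge0.
Qed.

Lemma expectation_from_le_offers_value h a :
  expectation_from M o (total_reward M) h a <=
  total_reward M h + offers_value (reward M) h (map snd a).
Proof.
elim: a h => [|[t k] a IH] h /=; first by rewrite offers_value_nil addr0.
rewrite offers_value_cons -{1}(offer_choice_sum1 h k (total_reward M h)).
rewrite -big_split; apply: ler_sum => S _ /=; rewrite -mulrDr.
apply: ler_wpM2l => //; rewrite -big_split; apply: ler_sum => n nS /=.
rewrite -mulrDr; apply: ler_wpM2l; first exact: choice_ge0.
apply: le_trans (IH _) _; rewrite addrA lerD2r.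
by rewrite /total_reward map_rcons; apply: reward_from_rcons.
Qed.

Hypothesis o_stock : forall h k S j, 0 < o h k S -> Some j \in val S ->
  (0 < inventory M h (resource M j))%N.

(** Only products in stock are offered, so each use of [l] really lowers its inventory by one, and
    the uses never exceed the initial stock. *)
Lemma offers_value_le_inventory l h s :
  offers_value (fun n => (uses M l n)%:R) h s <= (inventory M h l)%:R.
Proof.
elim: s h => [|k s IH] h; first by rewrite offers_value_nil.
rewrite offers_value_cons -[leRHS](offer_choice_sum1 h k).
apply: ler_sum => S _.
(* The stock hypothesis covers only assortments offered with positive probability; the others
   contribute 0. *)
have := o_ge0 h k S; rewrite le_eqVlt => /orP[/eqP <-|oS]; first by rewrite !mul0r.
apply: ler_wpM2l; first exact: ltW.
apply: ler_sum => n nS; apply: ler_wpM2l; first exact: choice_ge0.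
apply: (le_trans (lerD (lexx _) (IH _))).
rewrite -natrD ler_nat /inventory map_rcons -cats1 foldl_cat /=.
rewrite -/(inventory M h).
case: n nS => [j|] //= jS; have st := o_stock oS jS.
rewrite st; have [e|] := eqVneq (resource M j) l; last by rewrite subn0.
by rewrite -e subnKC.
Qed.

End offers.

(** * The law of the type counts *)

Section arrival_law.
Context (R : realType) (L N K : nat) (M : model R L N K).
Context (d : measure_display) (Omega : measurableType d).
Variables (P : probability Omega R) (A : Omega -> arrivals R K).
Hypothesis hA : is_arrival_process P M A.

Definition types (w : Omega) : seq 'I_K := map snd (A w).

Lemma measurable_types (Q : set (seq 'I_K)) : measurable [set w | Q (types w)].
Proof.
have -> : [set w | Q (types w)] =
    \bigcup_(s : seq 'I_K) (if `[< Q s >] then [set w | types w = s] else set0).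
  apply/seteqP; split => w /=.
    by move=> Qw; exists (types w) => //; case: asboolP.
  by move=> [s _]; case: asboolP => // Qs /= ->.
apply: countable_bigcupT_measurable => [|s]; first exact: countableP.
case: asboolP => // _; have [mA _ _ _] := hA.
rewrite -[X in measurable X]setTI.
apply: (mA measurableT [set a : arrival_space R K | map snd a = s]).
by apply: sub_sigma_algebra; left; exists s.
Qed.

(** The type sequence takes countably many values, so measurability can be checked on each piece of
    the partition it induces. *)
Lemma measurable_fun_types (g : seq 'I_K -> Omega -> R) :
  (forall s, measurable_fun setT (g s)) ->
  measurable_fun setT (fun w => g (types w) w).
Proof.
move=> mg _ B mB; rewrite setTI.
have -> : (fun w => g (types w) w) @^-1` B =
    \bigcup_(s : seq 'I_K) ([set w | types w = s] `&` (g s @^-1` B)).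
  by apply/seteqP; split => w /= => [Bw|[s _ [<-]]] //; exists (types w).
apply: countable_bigcupT_measurable => [|s]; first exact: countableP.
apply: measurableI; first exact: (measurable_types [set s' | s' = s]).
by rewrite -[X in measurable X]setTI; apply: mg.
Qed.

Lemma count_in_horizon k w :
  count_in [set` `[0, 1]%R] (type_times k (A w)) = count_mem k (types w).
Proof.
have [_ /(_ w)[_ A01] _ _] := hA.
rewrite /count_in /type_times /types.
elim: (A w) A01 => [|[t k'] a IH] //= A01.
have {}IH := IH (fun p pa => A01 p (mem_behead (s := (t, k') :: a) pa)).
case: ifP => /= _; rewrite IH //; congr (_ + _)%N.
rewrite mem_set //= in_itv /=; apply: (A01 (t, k')); exact: mem_head.
Qed.

Lemma subhorizon_unit : subhorizon (`[0, 1]%R : interval R).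
Proof. by []. Qed.

Lemma prob_count k (n : nat) :
  P [set w | count_mem k (types w) = n] = (poisson_weight (Lambda M k) n)%:E.
Proof.
have [_ _ /(_ k)[/(_ _ subhorizon_unit [set n]) + _] _] := hA.
have -> : [set w | count_mem k (types w) = n] =
  [set w | [set n] (count_in [set` `[0, 1]%R] (type_times k (A w)))].
  by apply/seteqP; split => w /=; rewrite count_in_horizon.
move=> ->; rewrite -[Rintegral _ _ _]/(Lambda M k) /poisson_prob.
have := Lambda_ge0 M k; rewrite le_eqVlt => /orP[/eqP <-|m0]; last first.
  by rewrite m0 esum_set1 ?lee_fin ?poisson_pmf_ge0 // /poisson_pmf m0.
rewrite ltxx /poisson_weight oppr0 expR0 mulr1 diracE.
case: n => [|n]; first by rewrite mem_set // expr0 invr1 mulr1.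
by rewrite memNset // expr0n mul0r.
Qed.

(** Independence of the processes is applied with the whole horizon as the single interval of each
    type. *)
Lemma prob_counts (c : 'I_K -> nat) :
  P [set w | forall k, count_mem k (types w) = c k] =
  (\prod_k poisson_weight (Lambda M k) (c k))%:E.
Proof.
have [_ _ _ /(_ 1%N (fun _ _ => `[0, 1]%R) (fun k _ => c k) (fun _ _ => subhorizon_unit))] := hA.
have -> : [set w | forall k (i : 'I_1), count_in [set` `[0, 1]%R] (type_times k (A w)) = c k] =
    [set w | forall k, count_mem k (types w) = c k].
  apply/seteqP; split => w /= H k; last by move=> _; rewrite count_in_horizon.
  by rewrite -count_in_horizon; apply: H ord0.
move=> ->; rewrite -prodEFin; apply: eq_bigr => k _.
rewrite -prob_count; congr (P _); apply/seteqP; split => w /=.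
  by move=> /(_ ord0); rewrite count_in_horizon.
by move=> H _; rewrite count_in_horizon.
Qed.

Lemma measurable_count k (n : nat) : measurable [set w | count_mem k (types w) = n].
Proof. exact: (measurable_types [set s | count_mem k s = n]). Qed.

(** Splitting by the value of the count gives a series whose partial sums are bounded by
    [poisson_mean_le]. *)
Lemma integral_count_le k :
  (\int[P]_w (count_mem k (types w))%:R%:E <= (Lambda M k)%:E)%E.
Proof.
pose F n := [set w | count_mem k (types w) = n].
have FT : \bigcup_n F n = setT.
  by apply/seteqP; split => w // _; exists (count_mem k (types w)).
rewrite -FT ge0_integral_bigcup; last 4 first.
- by move=> n; apply: measurable_count.
- rewrite FT; apply/measurable_EFinP.
  apply: (measurable_fun_types (g := fun s _ => (count_mem k s)%:R)) => s.
  exact: measurable_cst.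
- by move=> w _; rewrite lee_fin.
- by apply/trivIsetP => i j _ _ ij; apply/seteqP; split => // w /= [Fi Fj]; move: ij; rewrite -Fi -Fj eqxx.
have E n : (\int[P]_(w in F n) (count_mem k (types w))%:R%:E =
            (n%:R * poisson_weight (Lambda M k) n)%:E)%E.
  rewrite (eq_integral (cst n%:R%:E)) => [|w]; last by rewrite inE => ->.
  rewrite integral_cst; last exact: measurable_count.
  by rewrite EFinM -prob_count.
under eq_eseriesr do rewrite E.
apply: lime_le.
  by apply: is_cvg_nneseries => n _ _; rewrite lee_fin mulr_ge0 // poisson_weight_ge0 // Lambda_ge0.
apply: nearW => b; rewrite sumEFin lee_fin big_mkord.
exact: poisson_mean_le (Lambda_ge0 M k).
Qed.

Lemma measurable_expectation_types (o : Omega -> history N -> 'I_K -> assortment N -> R)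
    (f : history N -> R) :
  (forall h k S, measurable_fun setT (fun w => o w h k S)) ->
  measurable_fun setT (fun w => expectation_from M (o w) f [::] (A w)).
Proof.
move=> mo.
(* The time 0 is a placeholder. For a fixed type sequence the expectation is a finite sum of
   products of offer probabilities and constants. *)
pose g s w := expectation_from M (o w) f [::] [seq (0 : R, k) | k <- s].
rewrite (_ : (fun w => _) = fun w => g (types w) w); last first.
  apply/funext => w; apply: expectation_from_types.
  by rewrite -map_comp map_id_in.
apply: measurable_fun_types => s; rewrite /g.
elim: s [::] => [|k s IH] h /=; first exact: measurable_cst.
apply: measurable_sum => S; apply: measurable_funM; first exact: mo.
under eq_fun do rewrite big_mkcond /=.
apply: measurable_sum => n; case: (n \in val S); last exact: measurable_cst.
by apply: measurable_funM; [exact: measurable_cst|exact: IH].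
Qed.

End arrival_law.

(** * Comparison with the CDLP *)

Section fcfs.
Context (R : realType) (L N K : nat) (M : model R L N K).
Context (d : measure_display) (Omega : measurableType d).
Variables (P : probability Omega R) (A : Omega -> arrivals R K).
Hypothesis hA : is_arrival_process P M A.

(** Polynomials with nonnegative coefficients are closed under all operations used in
    [request_poly]. *)
Lemma request_poly_coef_ge0 (x : 'I_K -> assortment N -> R) j (c : 'I_K -> nat) i :
  (forall k S, 0 <= x k S) -> 0 <= (request_poly M x j c)`_i.
Proof.
move=> x0; move: i; pose nneg (p : {poly R}) := forall i, 0 <= p`_i.
have nneg0 : nneg 0 by move=> i; rewrite coef0.
have nneg1 : nneg 1 by move=> i; rewrite coef1.
have nnegXn n : nneg 'X^n by move=> i; rewrite coefXn.
have nnegD p q : nneg p -> nneg q -> nneg (p + q).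
  by move=> p0 q0 i; rewrite coefD addr_ge0.
have nnegM p q : nneg p -> nneg q -> nneg (p * q).
  by move=> p0 q0 i; rewrite coefM sumr_ge0 // => n _; rewrite mulr_ge0.
have nnegZ a p : 0 <= a -> nneg p -> nneg (a *: p).
  by move=> a0 p0 i; rewrite coefZ mulr_ge0.
have nnegX p n : nneg p -> nneg (p ^+ n).
  by move=> p0; elim: n => [|n IH]; [rewrite expr0|rewrite exprS; apply: nnegM].
rewrite /request_poly; apply: (big_ind nneg nneg0 nnegD) => // k0 _; apply: (nnegZ).
  by rewrite mulr_ge0 // purchase_prob_ge0.
apply: (nnegM); first exact: (nnegXn 1%N).
apply: (big_ind nneg nneg1 nnegM) => k _.
apply: (nnegX); apply: (big_ind nneg nneg0 nnegD) => // S _.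
apply: (nnegZ) => //; apply: (big_ind nneg nneg0 nnegD) => // o oS; apply: (nnegZ) => //.
exact: choice_ge0.
Qed.

Variable x : 'I_K -> assortment N -> R.
Hypothesis feas : CDLP_feasible M x.

Let x_ge0 k S : 0 <= static_offer x k S.
Proof. by have [_ x1 x0] := feas; apply: static_offer_ge0. Qed.

Let sales (c : 'I_K -> nat) : R :=
  \sum_(j < N) price M j * \sum_(i < (capacity M (resource M j)).+1)
     (request_poly M (static_offer x) j c)`_i.

Let sales_ge0 c : 0 <= sales c.
Proof.
apply: sumr_ge0 => j _; apply: mulr_ge0; first exact: price_ge0.
by apply: sumr_ge0 => i _; apply: request_poly_coef_ge0.
Qed.

(* A finite sum over counts below [b], so that the bound [b --> oo] is a limit of
   finite products of partial sums. *)
Lemma V_FCFS_ge_truncated (b : nat) :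
  ((\sum_(c : {ffun 'I_K -> 'I_b})
      (\prod_k poisson_weight (Lambda M k) (c k)) * sales (fun k => c k))%:E
   <= V_FCFS M P A x)%E.
Proof.
pose E (c : {ffun 'I_K -> 'I_b}) := [set w | forall k, count_mem k (types A w) = c k].
have mE c : measurable (E c).
  exact: (measurable_types hA [set s | forall k, count_mem k s = c k]).
have <- : (\int[P]_w (\sum_(c : {ffun 'I_K -> 'I_b}) (sales (fun k => c k))%:E * (\1_(E c) w)%:E)
   = (\sum_(c : {ffun 'I_K -> 'I_b})
      (\prod_k poisson_weight (Lambda M k) (c k)) * sales (fun k => c k))%:E)%E.
  rewrite ge0_integral_sum //; last 2 first.
  - move=> c; apply/measurable_EFinP.
    apply: measurable_funM; first exact: measurable_cst.
    exact: measurable_indic.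
  - by move=> c w _; rewrite -EFinM lee_fin mulr_ge0.
  rewrite -sumEFin; apply: eq_bigr => c _.
  rewrite ge0_integralZl_EFin //; last first.
  - apply/measurable_EFinP.
    exact: measurable_indic.
  by rewrite integral_indic // setIT EFinM muleC -(prob_counts hA).
apply: ge0_le_integral => //.
- by move=> w _; apply: sume_ge0 => c _; rewrite -EFinM lee_fin mulr_ge0.
- apply: emeasurable_sum => c; apply/measurable_EFinP.
  apply: measurable_funM; first exact: measurable_cst.
  exact: measurable_indic.
- apply/measurable_EFinP.
  apply: (measurable_expectation_types hA) => h k S; exact: measurable_cst.
move=> w _; under eq_bigr do rewrite -EFinM.
rewrite sumEFin lee_fin.
have pos : 0 <= expected_reward M (fun _ => static_offer x) (A w).
  by apply: expectation_from_ge0 => // h; apply: reward_from_ge0.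
(* The events [E c] are disjoint: at most one term survives, and none when some count is [b] or
   more, where nonnegativity of the reward suffices. *)
have [[c Ec]|nE] := pselect (exists c, E c w); last first.
  rewrite big1 // => c _; rewrite indicE memNset ?mulr0 // => Ec.
  by apply: nE; exists c.
rewrite (bigD1 c) //= big1 ?addr0 => [|c' c'c].
  rewrite indicE mem_set // mulr1.
  have -> : (fun k => nat_of_ord (c k)) = (fun k => count_mem k (types A w)).
    by apply/funext => k; apply: esym; apply: Ec.
  exact: expected_reward_ge.
rewrite indicE memNset ?mulr0 // => Ec'; move/eqP: c'c; apply.
by apply/ffunP => k; apply/val_inj; rewrite /= -(Ec k) -(Ec' k).
Qed.

Lemma V_FCFS_ge : (((expR 1)^-1 * CDLP_objective M x)%:E <= V_FCFS M P A x)%E.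
Proof.
apply: le_trans (_ : (\sum_(j < N) price M j *
  \sum_(i < capacity M (resource M j))
    (\sum_k Lambda M k * purchase_prob M (static_offer x) j k) *
    poisson_weight (mean_demand M (Lambda M) (static_offer x) (resource M j)) i)%:E
  <= _)%E; first by rewrite lee_fin; apply: CDLP_objective_le_sales.
apply: (@cvge_to_le _ \oo _ _ (fun b => (\sum_(c : {ffun 'I_K -> 'I_b})
      (\prod_k poisson_weight (Lambda M k) (c k)) * sales (fun k => c k))%:E));
  last by apply: nearW => b; apply: V_FCFS_ge_truncated.
apply: cvg_EFin; first exact: nearW.
rewrite /=.
have E b : \sum_(c : {ffun 'I_K -> 'I_b})
    (\prod_k poisson_weight (Lambda M k) (c k)) * sales (fun k => c k) =
  \sum_(j < N) price M j * \sum_(i < capacity M (resource M j))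
    (\sum_(c : {ffun 'I_K -> 'I_b}) (\prod_k poisson_weight (Lambda M k) (c k)) *:
      request_poly M (static_offer x) j (fun k => c k))`_i.+1.
  under eq_bigr do rewrite /sales mulr_sumr.
  rewrite exchange_big; apply: eq_bigr => j _ /=.
  under eq_bigr do rewrite mulrCA mulr_sumr.
  (* The factor X kills the coefficient of degree 0, so total demand at most the capacity becomes
     other demand strictly below it. *)
  rewrite -mulr_sumr; congr (_ * _); rewrite exchange_big big_ord_recl /=.
  rewrite big1 ?add0r => [|c _]; last first.
    rewrite /request_poly coef_sum [X in _ * X]big1 ?mulr0 // => k _.
    by rewrite coefZ coefXM mulr0.
  apply: eq_bigr => i _; rewrite coef_sum; apply: eq_bigr => c _.
  by rewrite coefZ.
under eq_fun do rewrite E.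
apply: cvg_big => [|j _]; first exact: add_continuous.
apply: cvgMr; apply: cvg_big => [|i _]; first exact: add_continuous.
apply: cvg_request_poly => k; exact: static_offer_sum1.
Qed.

End fcfs.

(** * Offline policies bounded by the CDLP *)

Section offline.
Context (R : realType) (L N K : nat) (M : model R L N K).
Context (d : measure_display) (Omega : measurableType d).
Variables (P : probability Omega R) (A : Omega -> arrivals R K).
Hypothesis hA : is_arrival_process P M A.
Variable policy : arrivals R K -> history N -> assortment N -> R.
Hypothesis hpol : is_offline_policy M policy.

(** Fixing the outcome turns the policy into an offer rule that ignores the type argument, as the
    realization already determines it. *)
Let o w (h : history N) (k : 'I_K) S : R := policy (A w) h S.

Let o_ge0 w h k S : 0 <= o w h k S.
Proof. by have [p0 _ _ _] := hpol; apply: p0. Qed.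

Let o_sum1 w h k : \sum_S o w h k S = 1.
Proof. by have [_ p1 _ _] := hpol; apply: p1. Qed.

Let o_measurable h k S : measurable_fun setT (fun w => o w h k S).
Proof.
have [_ _ mp _] := hpol; have [mA _ _ _] := hA.
exact: measurableT_comp (mp h S) mA.
Qed.

Let Y k S w := expected_offers M (o w) k S [::] (types A w).

Let Y_ge0 k S w : 0 <= Y k S w.
Proof. exact: expected_offers_ge0. Qed.

Let Y_measurable k S : measurable_fun setT (Y k S).
Proof.
apply: (measurable_fun_types hA (g := fun s w => expected_offers M (o w) k S [::] s)).
move=> s; elim: s [::] => [|k0 s IH] h /=; first exact: measurable_cst.
apply: measurable_funD.
  by apply: measurable_funM; [exact: measurable_cst|exact: o_measurable].
apply: measurable_sum => S'; apply: measurable_funM; first exact: o_measurable.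
under eq_fun do rewrite big_mkcond /=.
apply: measurable_sum => n; case: (n \in val S'); last exact: measurable_cst.
by apply: measurable_funM; [exact: measurable_cst|exact: IH].
Qed.

Let Y_sum k w : \sum_S Y k S w = (count_mem k (types A w))%:R.
Proof. exact: sum_expected_offers. Qed.

Let ybar k S := (\int[P]_w (Y k S w)%:E)%E.

Let ybar_ge0 k S : (0 <= ybar k S)%E.
Proof. by apply: integral_ge0 => w _; rewrite lee_fin. Qed.

Let Y_measurableE k S : measurable_fun setT (fun w => (Y k S w)%:E).
Proof. exact/measurable_EFinP. Qed.

Let ybar_sum k : (\sum_S ybar k S <= (Lambda M k)%:E)%E.
Proof.
rewrite -ge0_integral_sum //; last by move=> S w _; rewrite lee_fin.
rewrite (eq_integral (fun w => (count_mem k (types A w))%:R%:E)) => [|w _].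
  exact: integral_count_le.
by rewrite sumEFin Y_sum.
Qed.

Let ybar_le k S : (ybar k S <= (Lambda M k)%:E)%E.
Proof.
apply: le_trans (ybar_sum k); rewrite (bigD1 S) //= leeDl //.
by apply: sume_ge0 => S' _.
Qed.

Let ybar_fin k S : ybar k S \is a fin_num.
Proof.
by rewrite ge0_fin_numE //; apply: le_lt_trans (ybar_le k S) _; rewrite ltry.
Qed.

Let y k S := fine (ybar k S).

Let y_ge0 k S : 0 <= y k S.
Proof. exact: fine_ge0. Qed.

Let y_sum k : \sum_S y k S <= Lambda M k.
Proof.
have := ybar_sum k; under eq_bigr do rewrite -[ybar _ _]fineK //.
by rewrite sumEFin lee_fin.
Qed.

Let mean_choice_ge0 g k S : (forall n, 0 <= g n) -> 0 <= mean_choice M g k S.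
Proof. by move=> g0; apply: sumr_ge0 => n nS; rewrite mulr_ge0 // choice_ge0. Qed.

Let offers_value_measurable g : measurable_fun setT
  (fun w => (offers_value M (o w) g [::] (types A w))%:E).
Proof.
apply/measurable_EFinP; apply: measurable_sum => k.
apply: measurable_sum => S.
by apply: measurable_funM; [exact: Y_measurable|exact: measurable_cst].
Qed.

Let integral_offers_value g : (forall n, 0 <= g n) ->
  (\int[P]_w (offers_value M (o w) g [::] (types A w))%:E =
   (\sum_k \sum_S y k S * mean_choice M g k S)%:E)%E.
Proof.
move=> g0; rewrite /offers_value.
under eq_integral do rewrite -sumEFin.
have mterm k S : measurable_fun setT (fun w => (Y k S w * mean_choice M g k S)%:E).
  apply/measurable_EFinP.
  by apply: measurable_funM; [exact: Y_measurable|exact: measurable_cst].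
rewrite ge0_integral_sum //; last 2 first.
- move=> k; under eq_fun do rewrite -sumEFin; apply: emeasurable_sum => S; exact: mterm.
- by move=> k w _; rewrite lee_fin sumr_ge0 // => S _; apply: mulr_ge0; [exact: Y_ge0|exact: mean_choice_ge0].
rewrite -sumEFin; apply: eq_bigr => k _.
under eq_integral do rewrite -sumEFin.
rewrite ge0_integral_sum //; [|exact: mterm|]; last first.
  by move=> S w _; rewrite lee_fin; apply: mulr_ge0; [exact: Y_ge0|exact: mean_choice_ge0].
rewrite -sumEFin; apply: eq_bigr => S _.
under eq_integral do rewrite mulrC EFinM.
rewrite ge0_integralZl_EFin //; last 3 first.
- by move=> w _; rewrite lee_fin; apply: Y_ge0.
- exact: Y_measurableE.
- exact: mean_choice_ge0.
by rewrite -[integral _ _ _]/(ybar k S) -[ybar k S]fineK // -EFinM mulrC.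
Qed.

(* If [Lambda M k = 0] then [y k S = 0], and the division returns [0]. *)
Let x k S := y k S / Lambda M k.

Let Lambda_x k S : Lambda M k * x k S = y k S.
Proof.
have [m0|m0] := eqVneq (Lambda M k) 0; last by rewrite /x mulrC divfK.
(* [ybar_le] bounds [y k S] by [Lambda M k], which is 0 here. *)
rewrite m0 mul0r; apply/eqP; rewrite eq_le y_ge0 /= -m0.
by rewrite -lee_fin fineK.
Qed.

(** The capacity constraint holds outcome by outcome through [offers_value_le_inventory] and is then
    integrated; the mass constraint is [y_sum] divided by the mean. *)
Let x_feasible : CDLP_feasible M x.
Proof.
split=> [l|k|k S].
- have -> : \sum_(k < K) Lambda M k * \sum_(j < N | resource M j == l)
      \sum_(S : assortment N | Some j \in val S) x k S * choice_prob M k (Some j) S =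
    \sum_k \sum_S y k S * mean_choice M (fun n => (uses M l n)%:R) k S.
    apply: eq_bigr => k _; transitivity (Lambda M k * demand_prob M x l k).
      by congr (_ * _); apply: eq_bigr => j _; rewrite purchase_probE.
    rewrite demand_probE mulr_sumr; apply: eq_bigr => S _.
    by rewrite mulrA Lambda_x.
  rewrite -lee_fin -integral_offers_value //.
  (* The capacity is written as the integral of a constant, so that the integrands can be
     compared. *)
  rewrite -[leRHS]mule1 -(probability_setT P) -integral_cst //.
  apply: ge0_le_integral => //.
  + move=> w _; rewrite lee_fin; apply: sumr_ge0 => k _; apply: sumr_ge0 => S _.
    by rewrite mulr_ge0 ?mean_choice_ge0 //; apply: Y_ge0.
  move=> w _; rewrite lee_fin.
  apply: (offers_value_le_inventory (o_ge0 w) (o_sum1 w) _ l [::]).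
  by have [_ _ _ stock] := hpol => h k S j; apply: stock.
- have := Lambda_ge0 M k; rewrite /x -mulr_suml le_eqVlt => /orP[/eqP <-|m0].
    by rewrite invr0 mulr0.
  by rewrite ler_pdivrMr // mul1r.
- by rewrite divr_ge0 ?Lambda_ge0.
Qed.

Lemma V_policy_le_CDLP : (V_policy M P A policy <= V_CDLP M)%E.
Proof.
apply: (@le_trans _ _ (CDLP_objective M x)%:E); last first.
  by apply: ereal_sup_ubound; exists x.
have -> : CDLP_objective M x = \sum_k \sum_S y k S * mean_choice M (reward M) k S.
  by apply: eq_bigr => k _; apply: eq_bigr => S _; rewrite Lambda_x.
rewrite -integral_offers_value; last exact: reward_ge0.
apply: ge0_le_integral => //.
- move=> w _; rewrite lee_fin; apply: expectation_from_ge0; first exact: o_ge0.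
  by move=> h; apply: reward_from_ge0.
- apply/measurable_EFinP; exact: (measurable_expectation_types hA).
move=> w _; rewrite lee_fin.
have := expectation_from_le_offers_value M (o_ge0 w) (o_sum1 w) [::] (A w).
by rewrite [total_reward _ _]/= add0r.
Qed.

End offline.

Theorem theorem4 (R : realType) (L N K : nat) (M : model R L N K)
    (d : measure_display) (Omega : measurableType d)
    (P : probability Omega R) (A : Omega -> arrivals R K)
    (hA : is_arrival_process P M A)
    (eps : R) (heps : 0 <= eps <= 1)
    (x : 'I_K -> assortment N -> R) (hx : CDLP_eps_optimal M eps x) :
  (((expR 1)^-1 * (1 - eps))%:E * V_OFF M P A <= V_FCFS M P A x)%E.
Proof.
have [feas opt] := hx; have /andP[_ eps1] := heps.
apply: le_trans (V_FCFS_ge hA feas).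
rewrite !EFinM -muleA lee_wpmul2l ?lee_fin ?invr_ge0 ?expR_ge0 //.
apply: le_trans opt; rewrite lee_wpmul2l ?lee_fin ?subr_ge0 //.
by apply: ge_ereal_sup => _ [policy hpol <-]; apply: V_policy_le_CDLP.
Qed.
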